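(* Let $\varphi$ be a $\mathbb{Z}^d$-valuation, let $v_1,\dots,v_d\in\mathbb{Z}^d$ be linearly independent and $I\subseteq[d]$. Then \[\sum_{n\ge0}\varphi\big(2n\,\widetilde\lozenge(I)\big)t^n=\frac{\sum_{K\subseteq[d]}b_\varphi(K)\,B_{|I\cup K|+1}(d+1,t)}{(1-t)^{d+1}}.\]
   Context: A $\mathbb{Z}^d$-valuation is a map $\varphi$ from lattice polytopes in $\mathbb{R}^d$ (including $\emptyset$) to an abelian group with $\varphi(\emptyset)=0$, $\varphi(P\cup Q)=\varphi(P)+\varphi(Q)-\varphi(P\cap Q)$ whenever $P,Q,P\cup Q,P\cap Q$ are lattice polytopes, and $\varphi(P+x)=\varphi(P)$ for $x\in\mathbb{Z}^d$. It is evaluated on a polytope $P$ with facets $F_1,\dots,F_m$ removed via $\varphi(P\setminus\bigcup F_i):=\varphi(P)-\sum_{\emptyset\ne T\subseteq[m]}(-1)^{|T|-1}\varphi(\bigcap_{i\in T}F_i)$, and on relative interiors via $\varphi(\operatorname{relint}P)=\sum_F(-1)^{\dim P-\dim F}\varphi(F)$ (nonempty faces). For $s\ge0$, $s\,\widetilde\lozenge(I)$ is the parallelepiped $\{\sum_{i=1}^d\lambda_iv_i:0\le\lambda_i\le s\}$ with the facets $\{\lambda_i=s\}$, $i\in I$, removed. For $K\subseteq[d]$, $b_\varphi(K)=\varphi(\operatorname{relint}\{\sum_{i\in K}\lambda_iv_i:0\le\lambda_i\le1\})$, with $b_\varphi(\emptyset)=\varphi(\{0\})$. Signed permutations: $B_m$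 is the set of pairs $(\sigma,\epsilon)$, $\sigma\in S_m$, $\epsilon\in\{\pm1\}^m$; with $\sigma_0=0,\epsilon_0=1$, $\operatorname{des}(\sigma,\epsilon)=|\{i\in\{0,\dots,m-1\}:\epsilon_i\sigma_i>\epsilon_{i+1}\sigma_{i+1}\}|$; $B_k(m,t)=\sum t^{\operatorname{des}(\sigma,\epsilon)}$ over $(\sigma,\epsilon)\in B_m$ with $\epsilon_m\sigma_m=m+1-k$. *)

(* Defs.v *)
From HB Require Import structures.
From mathcomp Require Import all_boot all_order all_fingroup all_algebra.
From mathcomp Require Import mathcomp_extra boolp classical_sets fsbigop.
From mathcomp Require Import reals.

Set Implicit Arguments.
Unset Strict Implicit.
Unset Printing Implicit Defensive.

Import Order.TTheory GRing.Theory Num.Theory.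

Local Open Scope classical_set_scope.
Local Open Scope ring_scope.

Section Polytopes.
Variables (R : realType) (d : nat).
Local Notation V := 'rV[R]_d.

Definition lattice_point (x : V) : Prop := x \is a mxOver (@Num.int R).

(* The convex hull of the empty sequence is empty. *)
Definition conv (s : seq V) : set V :=
  [set x | exists w : 'I_(size s) -> R,
    [/\ forall i, 0 <= w i, \sum_i w i = 1 & x = \sum_i w i *: s`_i]].

Definition lattice_polytope (P : set V) : Prop :=
  exists2 s : seq V, {in s, forall x, lattice_point x} & P = conv s.

Definition translate (x : V) (P : set V) : set V := [set y + x | y in P].

(* The set of points of P maximizing the functional x |-> <c, x>; c = 0 gives
   P itself. *)
Definition face_in_direction (P : set V) (c : V) : set V :=
  [set x | P x /\ forall y, P y -> (y *m c^T) 0 0 <= (x *m c^T) 0 0].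

Definition nonempty_faces (P : set V) : set (set V) :=
  [set F | F !=set0 /\ exists c, F = face_in_direction P c].

(* The dimension of the smallest affine subspace containing a nonempty P: an
   affine subspace with direction U through a point of P contains P iff U
   contains all the differences of points of P. *)
Definition polytope_dim (P : set V) : nat :=
  \big[minn/d]_(k < d.+1 |
    `[< exists2 U : {vspace V}, \dim U = k &
          forall x y, P x -> P y -> x - y \in U >]) (k : nat).

(* {sum_(i in K) lam_i v_i : 0 <= lam_i <= s} *)
Definition parallelepiped (v : 'I_d -> V) (K : {set 'I_d}) (s : R) : set V :=
  [set x | exists2 lam : 'I_d -> R,
     forall i, 0 <= lam i <= s & x = \sum_(i in K) lam i *: v i].

(* The part lam_i = s of {sum_(j < d) lam_j v_j : 0 <= lam_j <= s} *)
Definition upper_facet (v : 'I_d -> V) (s : R) (i : 'I_d) : set V :=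
  [set x | exists lam : 'I_d -> R,
     [/\ forall j, 0 <= lam j <= s, lam i = s & x = \sum_j lam j *: v j]].

Section Valuations.
Variable G : zmodType.

(* phi is a total function on subsets of R^d, but only its values on lattice
   polytopes are constrained or used. *)
Record Zd_valuation (phi : set V -> G) : Prop := {
  val_empty : phi set0 = 0;
  val_union : forall P Q : set V,
    lattice_polytope P -> lattice_polytope Q ->
    lattice_polytope (P `|` Q) -> lattice_polytope (P `&` Q) ->
    phi (P `|` Q) = phi P + phi Q - phi (P `&` Q);
  val_translate : forall (P : set V) (x : V),
    lattice_polytope P -> lattice_point x -> phi (translate x P) = phi P
}.

Variable phi : set V -> G.

(* phi (P \ \bigcup_(i in I) F i) *)
Definition val_removed (T : finType) (P : set V) (F : T -> set V)
    (I : {set T}) : G :=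
  phi P - \sum_(S : {set T} | (S \subset I) && (S != finset.set0))
            phi (\bigcap_(i in [set` S]) F i) *~ (-1) ^+ (#|S| - 1).

(* phi (relint P) *)
Definition val_relint (P : set V) : G :=
  \sum_(F \in nonempty_faces P)
     phi F *~ (-1) ^+ (polytope_dim P - polytope_dim F).

(* phi (s \tilde\lozenge(I)) *)
Definition val_halfopen (v : 'I_d -> V) (I : {set 'I_d}) (s : R) : G :=
  val_removed (parallelepiped v finset.setT s) (upper_facet v s) I.

Definition val_b (v : 'I_d -> V) (K : {set 'I_d}) : G :=
  val_relint (parallelepiped v K 1).

End Valuations.
End Polytopes.

Section SignedPermutations.
Variable m : nat.

(* The sign eps_i is (-1) ^+ b, so that true stands for -1. *)
Definition signed_perm : finType := ('S_m * {ffun 'I_m -> bool})%type.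

(* eps_i sigma_i for i in {0, ..., m}, where eps_0 sigma_0 = 0; the values of
   elements of 'S_m are shifted from {0, ..., m-1} to {1, ..., m}. *)
Definition signed_letter (w : signed_perm) (i : 'I_m.+1) : int :=
  if unlift ord0 i is Some j then (-1) ^+ (w.2 j) * ((w.1 j).+1)%:Z else 0.

Definition des (w : signed_perm) : nat :=
  #|[pred i : 'I_m | signed_letter w (lift ord0 i)
                     < signed_letter w (widen_ord (leqnSn m) i)]|.

End SignedPermutations.

(* B_k(m, t) *)
Definition typeB_eulerian (k m : nat) : {poly int} :=
  \sum_(w : signed_perm m | signed_letter w ord_max == (m.+1)%:Z - k%:Z)
     'X^(des w).

(* Product of a polynomial over Z with a formal power series over an abelian
   group, the latter given by its sequence of coefficients. *)
Definition poly_mul_series (G : zmodType) (p : {poly int}) (f : nat -> G) :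
    nat -> G :=
  fun n => \sum_(i < n.+1) f (n - i)%N *~ p`_i.

(* The constant g in G times a polynomial over Z, as a formal power series. *)
Definition poly_to_series (G : zmodType) (g : G) (p : {poly int}) : nat -> G :=
  fun n => g *~ p`_n.

(* Main.v *)
Require Import Defs.
From mathcomp Require Import all_boot all_order all_fingroup all_algebra.
From mathcomp Require Import classical_sets reals.
From mathcomp Require Import boolp fsbigop zify ring.

Import Order.TTheory GRing.Theory Num.Theory.
Local Open Scope ring_scope.

(** Cutting a half-open box of side s into lattice translates of relatively open
    unit boxes suggests
      phi(s lozenge(I)) = sum_K b(K) s^|I u K| (s + 1)^(d - |I u K|).
    Algebraically, translation invariance and additivity make the value of phi
    on a box affine in each side length, so it is interpolated from the boxes
    with sides 0 and 1, and the coefficients on both sides of the formula factor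
    over the coordinates.

    It remains to see that (2n)^j (2n + 1)^(d - j) has generating function
    B_(j+1)(d + 1, t) / (1 - t)^(d + 1). Deleting the last letter of a signed
    permutation gives a recurrence for the descent polynomials refined by the
    last letter. For a last letter i > 0, resp. -i < 0, in size m + 1 the
    corresponding sequences are (2n)^(m + 1 - i) (2n + 1)^(i - 1), resp.
    (2n)^(m + 1 - i) (2n - 1)^(i - 1); they satisfy the same recurrence because
    the sums over the previous letter telescope. *)

(** * Descents of signed permutations, refined by the last letter *)

Section SignedPermutationRecurrence.

Lemma lift_perm_onto (n : nat) (i j : 'I_n.+1) (s : 'S_n.+1) :
  s i = j -> exists t : 'S_n, s = lift_perm i j t.
Proof.
move=> sij; pose f k := odflt k (unlift j (s (lift i k))).
have fE k : lift j (f k) = s (lift i k).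
  rewrite /f; have: j != s (lift i k) by rewrite -sij (inj_eq perm_inj) neq_lift.
  by case/unlift_some => l -> ->.
have f_inj : injective f.
  by move=> k l fkl; apply/(@lift_inj _ i)/(@perm_inj _ s); rewrite -!fE fkl.
exists (perm f_inj); apply/permP => k.
case: (unliftP i k) => [l|] ->; last by rewrite lift_perm_id.
by rewrite lift_perm_lift permE fE.
Qed.

(** Inverse to deleting the last letter and standardizing absolute values: [lift_perm] raises the
    old values from [j] on. *)
Definition append_letter (m : nat) (b : bool) (j : 'I_m.+1)
    (w : signed_perm m) : signed_perm m.+1 :=
  (lift_perm ord_max j w.1,
   [ffun k => if unlift ord_max k is Some l then w.2 l else b]).

Lemma append_letter_inj (m : nat) b j : injective (@append_letter m b j).
Proof.
move=> [s e] [t f] [/permP st /ffunP ef]; congr (_, _).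
  apply/permP => k; apply: (@lift_inj _ j).
  by have := st (lift ord_max k); rewrite !lift_perm_lift.
by apply/ffunP => k; have := ef (lift ord_max k); rewrite !ffunE liftK.
Qed.

Lemma append_letter_onto (m : nat) (w : signed_perm m.+1) :
  exists w', w = append_letter m (w.2 ord_max) (w.1 ord_max) w'.
Proof.
case: w => s e; have [t st] := lift_perm_onto m ord_max _ s erefl.
exists (t, [ffun k => e (lift ord_max k)]); rewrite /append_letter -st.
congr (_, _); apply/ffunP => k; rewrite ffunE.
by case: (unliftP ord_max k) => [l|] ->; rewrite ?ffunE.
Qed.

(* The integer form of [bump j] on absolute values: it makes room for the
   letters j+1 and -(j+1). *)
Definition bumpz (j : nat) (x : int) : int :=
  if j%:Z < x then x + 1 else if x < - j%:Z then x - 1 else x.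

Lemma ltz_bumpz j x y : (bumpz j x < bumpz j y) = (x < y).
Proof.
rewrite /bumpz.
case: (ltP j%:Z x) => ?; case: (ltP x (- j%:Z)) => ?; case: (ltP j%:Z y) => ?;
  by case: (ltP y (- j%:Z)) => ?; lia.
Qed.

Lemma bumpz0 j : bumpz j 0 = 0.
Proof. by rewrite /bumpz; case: ltP => ?; [lia | case: ltP => ?; lia]. Qed.

Lemma bumpz_letter j (b : bool) k :
  bumpz j ((-1) ^+ b * k.+1%:Z) = (-1) ^+ b * (bump j k).+1%:Z.
Proof.
rewrite /bumpz /bump; case: b; rewrite ?expr1 ?expr0 ?mulN1r ?mul1r;
  by case: (leqP j k) => ?; (case: ltP => ?; [lia | case: ltP => ?; lia]).
Qed.

Lemma signed_letter_append (m : nat) b j (w : signed_perm m) (i : 'I_m.+1) :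
  signed_letter (append_letter m b j w) (widen_ord (leqnSn m.+1) i)
  = bumpz j (signed_letter w i).
Proof.
rewrite /signed_letter; case: (unliftP ord0 i) => [k|] ->; last first.
  rewrite (_ : widen_ord _ _ = ord0) ?unlift_none ?bumpz0 //.
  exact: val_inj.
rewrite (_ : widen_ord _ _ = lift ord0 (lift ord_max k)); last first.
  by apply: val_inj; rewrite /= /bump (leqNgt m k) ltn_ord.
by rewrite liftK /= lift_perm_lift ffunE liftK bumpz_letter.
Qed.

Lemma signed_letter_append_last (m : nat) b j (w : signed_perm m) :
  signed_letter (append_letter m b j w) ord_max = (-1) ^+ b * (j.+1)%:Z.
Proof.
rewrite /signed_letter (_ : ord_max = lift ord0 ord_max); last exact: val_inj.
by rewrite liftK /= lift_perm_id ffunE unlift_none.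
Qed.

(** As [bumpz j] is strictly increasing, old descents persist and only the new last position can add
    one. *)
Lemma des_append (m : nat) b j (w : signed_perm m) :
  des (append_letter m b j w) =
  (des w + ((-1) ^+ b * (j.+1)%:Z < bumpz j (signed_letter w ord_max))%R)%N.
Proof.
rewrite /des -!sum1_card big_mkcond big_ord_recr /=; congr (_ + _)%N.
  rewrite [RHS]big_mkcond; apply: eq_bigr => i _; rewrite !inE.
  rewrite (_ : lift ord0 (widen_ord _ i) = widen_ord (leqnSn m.+1) (lift ord0 i));
    last by exact: val_inj.
  by rewrite !signed_letter_append ltz_bumpz.
rewrite inE (_ : lift ord0 ord_max = ord_max); last exact: val_inj.
by rewrite signed_letter_append_last signed_letter_append; case: (_ < _).
Qed.

Definition desgf (m : nat) (b : bool) (j : 'I_m.+1) : {poly int} :=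
  \sum_(w : signed_perm m.+1 | (w.2 ord_max == b) && (w.1 ord_max == j))
    'X^(des w).

Lemma desgf_append (m : nat) b j :
  desgf m b j =
  \sum_(w : signed_perm m)
    'X^(des w + ((-1) ^+ b * (j.+1)%:Z < bumpz j (signed_letter w ord_max))%R).
Proof.
rewrite /desgf (reindex (append_letter m b j)) /=; last first.
  (* On the fibre given by [b] and [j] a preimage exists, so the default is never reached. *)
  exists (fun w => odflt (1%g, [ffun=> false])
                   [pick w' | append_letter m b j w' == w]) => w /=.
    move=> _; case: pickP => [w' /eqP/append_letter_inj //|].
    by move=> /(_ w); rewrite eqxx.
  rewrite inE => /andP[/eqP wb /eqP wj]; case: pickP => [w' /eqP //|].
  have [w' ww'] := append_letter_onto _ w.
  by move=> /(_ w'); rewrite -wb -wj -ww' eqxx.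
apply: eq_big => [w|w _]; last by rewrite des_append.
by rewrite lift_perm_id ffunE unlift_none !eqxx.
Qed.

Lemma desgf_base b j : desgf 0 b j = 'X^b.
Proof.
rewrite desgf_append (bigD1 (1%g, [ffun=> false])) //= big1 ?addr0; last first.
  move=> [s e] /eqP[]; congr (_, _); first by apply/permP => -[].
  by apply/ffunP => -[].
rewrite (_ : des _ = 0%N); last by rewrite /des eq_card0 // => -[].
rewrite (_ : ord_max = ord0); last exact: val_inj.
by rewrite /signed_letter unlift_none ord1 bumpz0; case: b.
Qed.

(** Split by the previous letter, of absolute value [k+1] before bumping. The last letter [j+1]
    makes a descent exactly after positive letters with [j <= k]; [-(j+1)] does so after every
    positive letter and after negative ones with [k < j]. *)
Lemma desgf_rec (m : nat) b (j : 'I_m.+2) :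
  desgf m.+1 b j =
    \sum_(k < m.+1) 'X^(b || (j <= k)%N) * desgf m false k
  + \sum_(k < m.+1) 'X^(b && (k < j)%N) * desgf m true k.
Proof.
rewrite desgf_append.
rewrite (partition_big (fun w : signed_perm m.+1 => w.2 ord_max) xpredT) //=.
rewrite big_bool addrC.
have part c : \sum_(w : signed_perm m.+1 | w.2 ord_max == c)
   'X^(des w + ((-1) ^+ b * (j.+1)%:Z < bumpz j (signed_letter w ord_max))%R) =
   \sum_(k < m.+1) 'X^(((-1) ^+ b * (j.+1)%:Z < bumpz j ((-1) ^+ c * (k.+1)%:Z))%R)
      * desgf m c k.
  rewrite (partition_big (fun w : signed_perm m.+1 => w.1 ord_max) xpredT) //=.
  apply: eq_bigr => k _; rewrite mulr_sumr.
  apply: eq_bigr => w /andP[/eqP wc /eqP wk].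
  rewrite exprD mulrC; congr ('X^((_ < bumpz j _)%R) * _).
  rewrite /signed_letter (_ : ord_max = lift ord0 ord_max); last exact: val_inj.
  by rewrite liftK wc wk.
rewrite !part; congr (_ + _); apply: eq_bigr => k _; congr ('X^_ * _);
  rewrite bumpz_letter /bump; case: b {part} => /=;
  rewrite ?expr1 ?expr0 ?mulN1r ?mul1r;
  by case: (leqP j k) => ?; lia.
Qed.

End SignedPermutationRecurrence.

(** * Generating functions of mixed powers *)

Section TypeBGeneratingFunction.

(* Coefficient of t^n in desgf m b j / (1 - t)^(m+1). For b = true it is a
   polynomial in n only for n > 0. *)
Definition box_count (m : nat) (b : bool) (j n : nat) : int :=
  if b then if n is 0 then 0 else n.*2%:Z ^+ (m - j) * (n.*2%:Z - 1) ^+ j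
  else n.*2%:Z ^+ (m - j) * (n.*2%:Z + 1) ^+ j.
Arguments box_count : simpl never.

(** Each summand times [x - y] is a difference of consecutive terms [y^(m+1-k) x^k], so the sum
    telescopes. *)
Lemma sum_mixed_powers (m p q : nat) (x y : int) :
  (p <= q <= m.+1)%N ->
  (x - y) * \sum_(p <= k < q) y ^+ (m - k) * x ^+ k
  = y ^+ (m.+1 - q) * x ^+ q - y ^+ (m.+1 - p) * x ^+ p.
Proof.
move=> /andP[pq qm].
rewrite -(telescope_sumr (fun k => y ^+ (m.+1 - k) * x ^+ k)) // mulr_sumr.
apply: eq_big_nat => k /andP[_ kq]; rewrite subSS subSn ?exprS; last by lia.
by ring.
Qed.

Lemma sum_box_count_pos (m p q n : nat) : (p <= q <= m.+1)%N ->
  \sum_(p <= k < q) box_count m false k n =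
  box_count m.+1 false q n - box_count m.+1 false p n.
Proof.
move=> pq; rewrite /box_count -sum_mixed_powers //.
by rewrite (_ : _ + 1 - _ = 1) ?mul1r //; ring.
Qed.

Lemma sum_box_count_neg (m p q n : nat) : (p <= q <= m.+1)%N ->
  \sum_(p <= k < q) box_count m true k n =
  box_count m.+1 true p n - box_count m.+1 true q n.
Proof.
case: n => [|n] pq; first by rewrite big1_eq subrr.
have := @sum_mixed_powers m p q (n.+1.*2%:Z - 1) n.+1.*2%:Z pq.
rewrite (_ : _ - 1 - _ = -1); last by ring.
by rewrite mulN1r => /(congr1 -%R); rewrite opprK opprB.
Qed.

(** Multiplication by [t] on coefficient sequences. *)
Definition prev_term (f : nat -> int) (n : nat) : int :=
  if n is n'.+1 then f n' else 0.

(** Since [2n - 1 = 2(n-1) + 1], the endpoint of the negative sum meets that of the shifted positive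
    sum. *)
Lemma box_count_pos_neg (m n : nat) :
  box_count m true m n = prev_term (box_count m false m) n.
Proof.
case: n => [//|n]; rewrite /box_count /= subnn !expr0 !mul1r.
by congr (_ ^+ _); lia.
Qed.

(** Both are [(2n)^(m+1)]; in size 0 the value [0^0] would break this at [n = 0]. *)
Lemma box_count_neg0_pos0 (m n : nat) :
  box_count m.+1 true 0 n = box_count m.+1 false 0 n.
Proof. by case: n => [|n]; rewrite /box_count !expr0 // mulr1 expr0n. Qed.

(** The counterpart of [desgf_rec] after multiplication by [1 - t]. The sums telescope to the left
    side plus endpoint terms, which cancel by the two preceding lemmas. *)
Lemma box_count_diff (m : nat) b (j n : nat) : (j <= m.+1)%N ->
  box_count m.+1 b j n - prev_term (box_count m.+1 b j) n =
    \sum_(0 <= k < m.+1)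
      (if b || (j <= k)%N then prev_term (box_count m false k) n
       else box_count m false k n)
  + \sum_(0 <= k < m.+1)
      (if b && (k < j)%N then prev_term (box_count m true k) n
       else box_count m true k n).
Proof.
move=> jm.
have prev_sum c p q : (p <= q <= m.+1)%N ->
    \sum_(p <= k < q) prev_term (box_count m c k) n =
    (prev_term (box_count m.+1 c q) n - prev_term (box_count m.+1 c p) n) *
      (-1) ^+ c.
  case: n => [|n] pq /=; first by rewrite big1_eq subrr mul0r.
  by case: c; rewrite ?sum_box_count_neg ?sum_box_count_pos ?mulr1 ?mulrN1 ?opprB.
have split_sum (F1 F2 : nat -> int) :
   \sum_(0 <= k < m.+1) (if (j <= k)%N then F1 k else F2 k) =
   \sum_(0 <= k < j) F2 k + \sum_(j <= k < m.+1) F1 k.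
  rewrite (big_cat_nat (n := j)) //=; congr (_ + _).
    by apply: eq_big_nat => k /andP[_ kj]; rewrite leqNgt kj.
  by apply: eq_big_nat => k /andP[-> _].
case: b => /=.
  under [X in _ = _ + X]eq_bigr do rewrite ltnNge if_neg.
  rewrite split_sum !prev_sum ?sum_box_count_neg ?jm ?leqnn //.
  rewrite box_count_pos_neg.
  have -> : prev_term (box_count m.+1 true 0) n = prev_term (box_count m.+1 false 0) n.
    by case: (n) => // k; exact: box_count_neg0_pos0.
  by rewrite !expr1 !expr0; ring.
rewrite split_sum !prev_sum ?sum_box_count_neg ?sum_box_count_pos ?jm ?leqnn //.
by rewrite box_count_pos_neg box_count_neg0_pos0 expr0; ring.
Qed.

Lemma eq_coef_mul (r p q : {poly int}) (n : nat) :
  (forall i, (i <= n)%N -> p`_i = q`_i) -> (r * p)`_n = (r * q)`_n.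
Proof.
move=> pq; rewrite !coefM; apply: eq_bigr => i _; rewrite pq //.
exact: leq_subr.
Qed.

(** Induction on [m]: one factor [1 - X] turns the series into the sums of [box_count_diff], and the
    other factors fall to the induction hypothesis. A truncation beyond [n] stands for the power
    series. *)
Lemma desgf_series (m : nat) b (j : 'I_m.+1) (n N : nat) : (n < N)%N ->
  ((1 - 'X) ^+ m.+1 * \poly_(k < N) box_count m b j k)`_n = (desgf m b j)`_n.
Proof.
elim: m b j n N => [|m IH] b j n N nN.
  rewrite expr1 desgf_base ord1 mulrBl mul1r coefB coefXM coefXn !coef_poly nN.
  rewrite (leq_ltn_trans (leq_pred n) nN).
  by case: b; case: n nN => [|[|n]] //= _; rewrite /box_count /= ?mulr1 ?subrr ?subr0.
pose S c k := \poly_(i < N) box_count m c k i.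
rewrite exprSr -mulrA.
rewrite (@eq_coef_mul _ _ (\sum_(k < m.+1) 'X^(b || (j <= k)%N) * S false k
  + \sum_(k < m.+1) 'X^(b && (k < j)%N) * S true k)).
  rewrite mulrDr coefD !mulr_sumr desgf_rec coefD !coef_sum.
  have shift c k (e : bool) :
      ((1 - 'X) ^+ m.+1 * ('X^e * S c (nat_of_ord k)))`_n = ('X^e * desgf m c k)`_n.
    rewrite mulrCA !coefXnM; case: ltnP => // _; rewrite IH //.
    by rewrite (leq_ltn_trans (leq_subr _ _) nN).
  by congr (_ + _); apply: eq_bigr => k _; rewrite shift.
move=> i ni; have iN := leq_ltn_trans ni nN.
rewrite mulrBl mul1r coefB coefXM coef_poly iN coef_poly.
rewrite (leq_ltn_trans (leq_pred i) iN).
have -> : (if i == 0%N then 0 else box_count m.+1 b j i.-1) =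
          prev_term (box_count m.+1 b j) i by case: (i).
rewrite box_count_diff ?leq_ord // coefD !coef_sum !big_mkord.
have shift c k (e : bool) : ('X^e * S c k)`_i =
    if e then prev_term (box_count m c k) i else box_count m c k i.
  case: e; last by rewrite expr0 mul1r coef_poly iN.
  rewrite coefXM coef_poly (leq_ltn_trans (leq_pred i) iN).
  by case: (i).
by congr (_ + _); apply: eq_bigr => k _; rewrite shift.
Qed.

Lemma typeB_eulerian_series (d j n : nat) : (j <= d)%N ->
  \sum_(i < n.+1) ((1 - 'X) ^+ d.+1)`_i *
     (((2 * (n - i))%:Z) ^+ j * ((2 * (n - i)).+1%:Z) ^+ (d - j))
  = (typeB_eulerian j.+1 d.+1)`_n.
Proof.
move=> jd; have dj : (d - j < d.+1)%N by rewrite ltnS leq_subr.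
(* The prescribed last letter [d + 2 - (j + 1) = (d - j) + 1] is positive, whence the sign [false]
   and the index [d - j]. *)
transitivity (desgf d false (Ordinal dj))`_n.
  rewrite -(@desgf_series _ _ _ _ n.+1) // coefM; apply: eq_bigr => i _.
  rewrite coef_poly ltnS leq_subr /box_count /= subKn // mul2n.
  by congr (_ * (_ * _ ^+ _)); lia.
rewrite /desgf /typeB_eulerian; congr ((polyseq _)`_n); apply: eq_bigl => w.
rewrite /signed_letter (_ : ord_max = lift ord0 ord_max); last exact: val_inj.
rewrite liftK -val_eqE /=.
by case: (w.2 _) => /=; have := ltn_ord (w.1 ord_max); lia.
Qed.

End TypeBGeneratingFunction.

(** * Product weights on subsets *)

Section ProductWeights.
Variables (R : comNzRingType) (T : finType) (t : T -> R).

(** For [t] in [[0, 1]], the law of a random subset containing each [j] independently with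
    probability [t j]. *)
Definition subset_weight (S : {set T}) : R :=
  \prod_j (if j \in S then t j else 1 - t j).

Lemma sum_subset_weight : \sum_S subset_weight S = 1.
Proof.
rewrite -[LHS]bigA_distr big1 // => j _ /=.
by rewrite addrC subrK.
Qed.

Lemma mean_subset_weight i (a b : R) :
  \sum_S subset_weight S * (if i \in S then a else b) = t i * a + (1 - t i) * b.
Proof.
pose F j := t j * (if j == i then a else 1).
pose H j := (1 - t j) * (if j == i then b else 1).
transitivity (\sum_(S : {set T}) \prod_j (if j \in S then F j else H j)).
  apply: eq_bigr => S _; rewrite /subset_weight (bigD1 i) //= [RHS](bigD1 i) //=.
  rewrite /F /H eqxx -mulrA [X in _ * X]mulrC mulrA; congr (_ * _).
    by case: ifP.
  by apply: eq_bigr => j /negbTE ->; rewrite !mulr1.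
rewrite -[LHS]bigA_distr (bigD1 i) //= big1 ?mulr1 => [|j /negbTE ji].
  by rewrite /F /H eqxx.
by rewrite /F /H ji !mulr1 addrC subrK.
Qed.

End ProductWeights.

Lemma prod_indicator (R : comNzRingType) (T : finType) (x : R) (A : {set T}) :
  x ^+ #|A| = \prod_i (if i \in A then x else 1).
Proof. by rewrite -big_mkcond /= prodr_const. Qed.

Lemma bigmin_ord_eq (d n : nat) (P : pred nat) :
  (n <= d)%N -> P n -> (forall k, P k -> (n <= k)%N) ->
  \big[minn/d]_(k < d.+1 | P k) (k : nat) = n.
Proof.
move=> nd Pn Pmin; apply/eqP; rewrite eqn_leq; apply/andP; split; last first.
  elim/big_rec: _ => // k x Pk nx.
  by rewrite leq_min nx Pmin.
have : Ordinal (nd : (n < d.+1)%N) \in index_enum 'I_d.+1 by rewrite mem_index_enum.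
elim: index_enum => // k r IH; rewrite big_cons inE => /orP[/eqP <-|/IH le].
  by rewrite Pn geq_minl.
by case: ifP => // _; rewrite geq_min le orbT.
Qed.

(** * Lattice boxes in the basis [v]: hulls, dimension, faces *)

Section Boxes.
Variables (R : realType) (d : nat) (v : 'I_d -> 'rV[R]_d).
Hypothesis v_lattice : forall i, lattice_point (v i).
Hypothesis v_free : free [tuple v i | i < d].

Local Open Scope classical_set_scope.

Definition comb (lam : 'I_d -> R) : 'rV[R]_d := \sum_i lam i *: v i.

Lemma comb_inj lam mu : comb lam = comb mu -> lam =1 mu.
Proof.
move=> lammu i; apply/eqP; rewrite -subr_eq0; apply/eqP.
move/freeP: v_free => /(_ (fun i => lam i - mu i)); apply.
under eq_bigr do rewrite -tnth_nth tnth_mktuple scalerBl.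
by rewrite sumrB; apply/eqP; rewrite subr_eq0; apply/eqP.
Qed.

Definition box (l u : 'I_d -> nat) : set 'rV[R]_d :=
  [set x | exists2 lam : 'I_d -> R,
     forall i, (l i)%:R <= lam i <= (u i)%:R & x = comb lam].

Lemma eq_box l l' u u' : l =1 l' -> u =1 u' -> box l u = box l' u'.
Proof. by move=> /funext -> /funext ->. Qed.

Lemma mem_box l u lam :
  box l u (comb lam) <-> forall i, (l i)%:R <= lam i <= (u i)%:R.
Proof.
split=> [[mu mub /comb_inj lammu] i|lamb]; last by exists lam.
by rewrite lammu.
Qed.

Lemma box_lower l u : (forall i, l i <= u i)%N -> box l u (comb (fun i => (l i)%:R)).
Proof. by move=> lu; apply/mem_box => i; rewrite lexx ler_nat lu. Qed.

Lemma box_upper l u : (forall i, l i <= u i)%N -> box l u (comb (fun i => (u i)%:R)).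
Proof. by move=> lu; apply/mem_box => i; rewrite lexx ler_nat lu. Qed.

Lemma box_subset l u l' u' : (forall i, l i <= u i)%N ->
  box l u `<=` box l' u' -> forall i, (l' i <= l i)%N /\ (u i <= u' i)%N.
Proof.
move=> lu sub i; split.
  have /sub/mem_box/(_ i)/andP[] := box_lower l u lu.
  by rewrite ler_nat.
have /sub/mem_box/(_ i)/andP[_] := box_upper l u lu.
by rewrite ler_nat.
Qed.

Lemma comb_lattice (a : 'I_d -> nat) : lattice_point (comb (fun i => (a i)%:R)).
Proof.
apply/mxOverP => i j; rewrite /comb summxE; apply: rpred_sum => k _.
by rewrite mxE rpredM ?rpred_nat //; have /mxOverP := v_lattice k.
Qed.

(** A vertex chooses one end of every side. A point of the box is the mean of the vertices under
    product weights, by linearity in each coordinate. *)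
Lemma box_lattice_polytope l u : (forall i, l i <= u i)%N ->
  lattice_polytope (box l u).
Proof.
move=> lu.
pose choice (S : {set 'I_d}) i := if i \in S then u i else l i.
pose vertex S := comb (fun i => (choice S i)%:R).
pose e := enum {set 'I_d}.
exists (map vertex e).
  by move=> x /mapP[S _ ->]; exact: comb_lattice.
have vE (k : 'I_(size (map vertex e))) :
    (map vertex e)`_k = vertex (nth finset.set0 e k).
  by rewrite (nth_map finset.set0) // -(size_map vertex).
have choice_ge S i : (l i <= choice S i)%N by rewrite /choice; case: ifP.
have choice_le S i : (choice S i <= u i)%N by rewrite /choice; case: ifP.
apply/seteqP; split => [x [lam lamb ->]|x [w [w0 w1 ->]]]; last first.
  exists (fun i => \sum_k w k * (choice (nth finset.set0 e k) i)%:R).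
    have constE (a : R) : a = \sum_k w k * a by rewrite -mulr_suml w1 mul1r.
    move=> i; apply/andP; split;
      [rewrite [X in X <= _]constE|rewrite [X in _ <= X]constE];
      apply: ler_sum => k _;
      by rewrite ler_wpM2l // ler_nat.
  rewrite /comb; under [RHS]eq_bigr do rewrite scaler_suml.
  rewrite exchange_big /=; apply: eq_bigr => k _.
  by rewrite vE scaler_sumr; apply: eq_bigr => i _; rewrite scalerA.
(* On a degenerate side the division by zero gives [t i = 0], which is harmless as both ends
   agree. *)
pose t i := (lam i - (l i)%:R) / ((u i)%:R - (l i)%:R).
have t01 i : 0 <= t i <= 1.
  have /andP[l1 l2] := lamb i.
  have : 0 <= (u i)%:R - (l i)%:R :> R by rewrite subr_ge0 ler_nat.
  rewrite le_eqVlt => /predU1P[ul|ul]; first by rewrite /t -ul invr0 mulr0 lexx ler01.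
  by rewrite /t divr_ge0 ?subr_ge0 ?ler_nat //= ler_pdivrMr // mul1r lerD2r.
have lamE i : t i * (u i)%:R + (1 - t i) * (l i)%:R = lam i.
  have [lu_eq|lu_neq] := eqVneq (u i) (l i).
    rewrite lu_eq -mulrDl addrC subrK mul1r.
    by apply/eqP; rewrite eq_le; have := lamb i; rewrite lu_eq.
  have nz : (u i)%:R - (l i)%:R != 0 :> R by rewrite subr_eq0 eqr_nat.
  by rewrite /t; field.
have sum_e (M : zmodType) (W : {set 'I_d} -> M) :
  \sum_(k < size (map vertex e)) W (nth finset.set0 e k) = \sum_S W S.
  rewrite -(big_mkord xpredT (fun k => W (nth finset.set0 e k))) size_map.
  by rewrite -(big_nth finset.set0 xpredT W) big_enum.
exists (fun k => subset_weight _ _ t (nth finset.set0 e k)); split.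
- move=> k; apply: prodr_ge0 => i _; have /andP[t0 t1] := t01 i.
  by case: ifP => _ //; rewrite subr_ge0.
- by rewrite sum_e sum_subset_weight.
under eq_bigr do rewrite vE.
rewrite (sum_e _ (fun S => subset_weight _ _ t S *: vertex S)) /vertex /comb.
under [RHS]eq_bigr do rewrite scaler_sumr.
rewrite exchange_big; apply: eq_bigr => i _ /=.
rewrite -lamE -mean_subset_weight scaler_suml; apply: eq_bigr => S _.
by rewrite scalerA /choice; case: ifP.
Qed.

Lemma translate_box l u (c : 'I_d -> nat) :
  translate (comb (fun i => (c i)%:R)) (box l u) =
  box (fun i => l i + c i)%N (fun i => u i + c i)%N.
Proof.
apply/seteqP; split => [_ [_ [lam lamb ->] <-]|_ [lam lamb ->]].
  exists (fun i => lam i + (c i)%:R) => [i|]; first by rewrite !natrD !lerD2r.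
  by rewrite /comb -big_split; apply: eq_bigr => i _; rewrite scalerDl.
exists (comb (fun i => lam i - (c i)%:R)).
  exists (fun i => lam i - (c i)%:R) => // i.
  by rewrite lerBrDr lerBlDr -!natrD.
rewrite /comb -big_split; apply: eq_bigr => i _ /=.
by rewrite scalerBl subrK.
Qed.

(** The [v i] along nondegenerate sides span all differences of points, and each of them is itself
    such a difference. *)
Lemma box_dim l u : (forall i, l i <= u i)%N ->
  polytope_dim (box l u) = #|[set i | (l i < u i)%N]%SET|.
Proof.
move=> lu; set L := [set i | _]%SET.
have v_inj : injective v.
  move=> i j vij; apply/eqP/negP => /negP ij.
  pose dl k : 'I_d -> R := fun i => (i == k)%:R.
  have combd k : comb (dl k) = v k.
    rewrite /comb (bigD1 k) //= big1 ?addr0; first by rewrite /dl eqxx scale1r.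
    by move=> h /negbTE hk; rewrite /dl hk scale0r.
  have := comb_inj (dl i) (dl j); rewrite !combd => /(_ vij i).
  by rewrite /dl eqxx (negbTE ij) => /eqP; rewrite oner_eq0.
pose X := [seq v i | i <- enum L].
have X_free : free X.
  have -> : X = filter (mem X) [tuple v i | i < d].
    rewrite /= filter_map /X enumT /= -enumT; congr map; rewrite {1}/enum_mem.
    rewrite -enumT; apply: eq_filter => i /=; rewrite mem_map //.
    by rewrite mem_enum.
  exact: filter_free.
have X_dim : \dim <<X>>%VS = #|L| by rewrite (eqP X_free) size_map -cardE.
apply: (@bigmin_ord_eq d #|L|
  (fun k => `[< exists2 U : {vspace 'rV[R]_d}, \dim U = k &
          forall x y, box l u x -> box l u y -> x - y \in U >])).
- by rewrite -[X in (_ <= X)%N]card_ord max_card.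
- apply/asboolP; exists <<X>>%VS => //.
  move=> _ _ [lam lamb ->] [mu mub ->]; rewrite /comb -sumrB.
  apply: rpred_sum => i _; rewrite -scalerBl.
  case: (boolP (i \in L)) => iL.
    by rewrite rpredZ // memv_span // map_f // mem_enum.
  have ul : u i = l i.
    by move: iL; rewrite inE -leqNgt => ?; apply/eqP; rewrite eqn_leq lu andbT.
  have := lamb i; have := mub i; rewrite ul => /le_anti <- /le_anti <-.
  by rewrite subrr scale0r rpred0.
move=> k /asboolP[U <- Udiff]; rewrite -X_dim dimvS //; apply/span_subvP.
move=> x /mapP[i]; rewrite mem_enum inE => lui ->.
have -> : v i = comb (fun j => (l j + (j == i))%:R) - comb (fun j => (l j)%:R).
  rewrite /comb -sumrB (bigD1 i) //= big1 ?addr0; last first.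
    by move=> j /negbTE ->; rewrite addn0 subrr.
  by rewrite eqxx -scalerBl natrD addrC addKr scale1r.
apply: Udiff; apply/mem_box => j; rewrite !ler_nat ?leqnn ?lu // leq_addr.
by case: eqVneq => [->|_] /=; rewrite ?addn1 ?addn0.
Qed.

Lemma exists_functional (c : 'I_d -> R) :
  exists f : 'rV[R]_d, forall i, (v i *m f^T) 0 0 = c i.
Proof.
pose M := \matrix_i v i.
have Mfree : row_free M.
  apply: inj_row_free => x xM; apply/rowP => i; rewrite mxE.
  apply: (comb_inj (x 0) (fun=> 0)); transitivity (x *m M).
    by rewrite mulmx_sum_row; apply: eq_bigr => j _; rewrite rowK.
  by rewrite xM /comb big1 // => j _; rewrite scale0r.
have Munit : M \in unitmx by rewrite -row_free_unit.
exists (invmx M *m \col_i c i)^T => i; rewrite trmxK.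
have -> : v i = row i M by rewrite rowK.
by rewrite -row_mul mulmxA mulmxV // mul1mx !mxE.
Qed.

Definition ind (K : {set 'I_d}) : 'I_d -> nat := fun i => i \in K.

Lemma comb_functional lam (f : 'rV[R]_d) :
  (comb lam *m f^T) 0 0 = \sum_i lam i * (v i *m f^T) 0 0.
Proof.
rewrite /comb mulmx_suml summxE; apply: eq_bigr => i _.
by rewrite -scalemxAl mxE.
Qed.

(** The functional is a sum over coordinates, so each coordinate in [K] is maximized alone: at 1 if
    [c i > 0], at 0 if [c i < 0], anywhere if [c i = 0]. *)
Lemma box_face (K : {set 'I_d}) (f : 'rV[R]_d) :
  let c i := (v i *m f^T) 0 0 in
  let A := [set i in K | 0 < c i]%SET in
  let L := [set i in K | c i == 0]%SET in
  face_in_direction (box (fun=> 0%N) (ind K)) f = box (ind A) (ind (A :|: L)).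
Proof.
move=> c A L; have AL i : (i \in A :|: L) = (i \in K) && (0 <= c i).
  by rewrite !inE -andb_orr orbC -eq_sym -le_eqVlt.
have iA i : (i \in A) = (i \in K) && (0 < c i) by rewrite inE.
apply/seteqP; split => [_ [[lam lamb ->] lam_max]|_ [lam lamb ->]].
  apply/mem_box => i; rewrite /ind AL iA.
  pose chg (x : R) : 'I_d -> R := fun j => if j == i then x else lam j.
  have chg_le x : 0 <= x <= (ind K i)%:R -> x * c i <= lam i * c i.
    move=> xb; have : box (fun=> 0%N) (ind K) (comb (chg x)).
      by apply/mem_box => j; rewrite /chg; case: eqP => [->|].
    move=> /lam_max; rewrite !comb_functional (bigD1 i) //= [X in _ <= X](bigD1 i) //=.
    rewrite (eq_bigr (fun j => lam j * c j)) ?lerD2r; last first.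
      by move=> j /negbTE ji; rewrite /chg ji.
    by rewrite /chg eqxx.
  have /andP[lam0 lam1] := lamb i; move: chg_le lam1; rewrite /ind.
  case: (i \in K) => /= chg_le lam1; last by rewrite lam0.
  case: (ltgtP 0 (c i)) => [c0|c0|_] /=; last by rewrite lam0.
    by rewrite lam1 andbT -(ler_pM2r c0) chg_le // ler01 lexx.
  by rewrite lam0 /= -(ler_nM2r c0) chg_le // ler01 lexx.
split=> [|_ [mu mub ->]].
  apply/mem_box => i; have /andP[l1 l2] := lamb i.
  rewrite (le_trans _ l1) ?ler_nat //= (le_trans l2) // ler_nat /ind AL.
  by case: (i \in K) => //=; rewrite leq_b1.
rewrite !comb_functional; apply: ler_sum => i _.
have := lamb i; have := mub i; rewrite /ind AL iA -/(c i).
case: (i \in K) => /= [/andP[m0 m1]|/le_anti <- /le_anti <- //].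
case: (ltgtP 0 (c i)) => [c0|c0|<-] /=; last by rewrite !mulr0.
  by move=> /le_anti <-; rewrite ler_pM2r.
by move=> /le_anti <-; rewrite ler_nM2r.
Qed.

(* The face of the unit box on K indexed by (L, A) has the coordinates in L
   free, those in A equal to 1, and the others equal to 0. *)
Definition face_index (K : {set 'I_d}) : {set {set 'I_d} * {set 'I_d}} :=
  [set q : {set 'I_d} * {set 'I_d} |
    (q.1 \subset K) && (q.2 \subset K :\: q.1)]%SET.

Lemma nonempty_faces_box (K : {set 'I_d}) :
  nonempty_faces (box (fun=> 0%N) (ind K)) =
  (fun q : {set 'I_d} * {set 'I_d} => box (ind q.2) (ind (q.2 :|: q.1))) @`
    [set` face_index K].
Proof.
apply/seteqP; split => [F [_ [f ->]]|F [[L A] /=]].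
  rewrite box_face; set A := [set i in K | 0 < _]%SET.
  set L := [set i in K | _ == _]%SET.
  exists (L, A) => //=; rewrite inE /= subsetD; apply/and3P; split.
  - by apply/fintype.subsetP => i; rewrite inE => /andP[].
  - by apply/fintype.subsetP => i; rewrite inE => /andP[].
  rewrite -setI_eq0; apply/eqP/setP => i; rewrite !inE.
  by case: (i \in K) => //=; case: ltgtP.
rewrite inE /= => /andP[LK]; rewrite subsetD => /andP[AK /pred0P AL] <-.
split.
  exists (comb (fun i => (ind A i)%:R)); apply: box_lower => i.
  by rewrite /ind inE; case: (i \in A).
(* By [box_face], these signs expose the face with index [(L, A)]. *)
have [f fE] := exists_functional
  (fun i => if i \in A then 1 else if i \in L then 0 else -1).
exists f; rewrite box_face.
have <- : A = [set i in K | 0 < (v i *m f^T) 0 0]%SET.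
  apply/setP => i; rewrite !inE fE.
  case: (boolP (i \in A)) => [/(fintype.subsetP AK) ->|_]; first by rewrite ltr01.
  by case: ifP; rewrite ?ltxx ?oppr_gt0 ?ltr10 andbF.
have <- : L = [set i in K | (v i *m f^T) 0 0 == 0]%SET; last by [].
apply/setP => i; rewrite !inE fE; have := AL i => /=.
case: (boolP (i \in A)) => [iA /= ->|iA _]; first by rewrite oner_eq0 andbF.
case: (boolP (i \in L)) => [/(fintype.subsetP LK) ->|_]; first by rewrite eqxx.
by rewrite oppr_eq0 oner_eq0 andbF.
Qed.

(** * Values of a valuation on boxes *)

Section ValuationOfBoxes.
Variables (G : zmodType) (phi : set 'rV[R]_d -> G).
Hypothesis phi_val : Zd_valuation phi.

Definition valbox (a : 'I_d -> nat) : G := phi (box (fun=> 0%N) a).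

Lemma val_box l u : (forall i, l i <= u i)%N ->
  phi (box l u) = valbox (fun i => u i - l i)%N.
Proof.
move=> lu; rewrite /valbox -[RHS](val_translate phi_val _ (comb_lattice l)).
  by rewrite translate_box; congr phi; apply: eq_box => i; rewrite ?subnK.
exact: box_lattice_polytope.
Qed.

Definition upd (a : 'I_d -> nat) i n : 'I_d -> nat :=
  fun j => if j == i then n else a j.

(** Cut at [lam i = p]: the slab above the cut and the wall translate to boxes with [i]-th side 1
    and 0. *)
Lemma valbox_step a i p :
  valbox (upd a i p.+1) = valbox (upd a i p) + valbox (upd a i 1) - valbox (upd a i 0).
Proof.
have step : box (fun=> 0%N) (upd a i p.+1) =
    box (fun=> 0%N) (upd a i p) `|` box (upd (fun=> 0%N) i p) (upd a i p.+1).
  apply/seteqP; split => [_ [lam lamb ->]|_ [] [lam lamb ->]].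
  - have [lamp|lamp] := leP (lam i) p%:R; [left|right]; apply/mem_box => j;
      have := lamb j; rewrite /upd; case: eqP => // -> /andP[l0 l1].
      by rewrite l0.
    by rewrite l1 ltW.
  - apply/mem_box => j; have /andP[-> l1] := lamb j; rewrite (le_trans l1) // ler_nat.
    by rewrite /upd; case: ifP.
  apply/mem_box => j; have /andP[l0 ->] := lamb j.
  by rewrite (le_trans _ l0).
have cap : box (fun=> 0%N) (upd a i p) `&` box (upd (fun=> 0%N) i p) (upd a i p.+1)
    = box (upd (fun=> 0%N) i p) (upd a i p).
  apply/seteqP; split => [_ [[lam lamb ->]] /mem_box lamb'|_ [lam lamb ->]].
    by apply/mem_box => j; have /andP[_ ->] := lamb j; have /andP[-> _] := lamb' j.
  split; apply/mem_box => j; have /andP[l0 l1] := lamb j; apply/andP; split => //.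
    by rewrite (le_trans _ l0).
  by rewrite (le_trans l1) // ler_nat /upd; case: ifP.
have le1 j : (upd (fun=> 0) i p j <= upd a i p.+1 j)%N by rewrite /upd; case: ifP.
have le2 j : (upd (fun=> 0) i p j <= upd a i p j)%N by rewrite /upd; case: ifP.
rewrite {1}/valbox step (val_union phi_val) ?cap -?step;
  try exact: box_lattice_polytope.
rewrite !val_box //; congr (phi _ + phi _ - phi _); apply: eq_box => // j;
  by rewrite /upd; case: ifP; rewrite ?subn0 ?subnn ?subSnn.
Qed.

Lemma valbox_affine a i :
  valbox a = valbox (upd a i 0) *~ (1 - (a i)%:Z) + valbox (upd a i 1) *~ (a i)%:Z.
Proof.
have {1}-> : a = upd a i (a i) by apply/funext => j; rewrite /upd; case: eqP => [->|].
elim: (a i) => [|p IH]; first by rewrite subr0 mulr1z mulr0z addr0.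
rewrite valbox_step IH (_ : 1 - p.+1%:Z = 1 - p%:Z - 1); last by lia.
rewrite (_ : p.+1%:Z = p%:Z + 1); last by lia.
rewrite (mulrzBr _ (1 - p%:Z) 1) (mulrzDr _ p%:Z 1) !mulr1z.
by rewrite -[X in X - _ = _]addrA addrAC.
Qed.

(** Multi-affine interpolation of [valbox] from the side vectors with entries 0 and 1. *)
Definition valbox_interp (a : 'I_d -> nat) : G :=
  \sum_(U : {set 'I_d})
    valbox (ind U) *~ \prod_i (if i \in U then (a i)%:Z else 1 - (a i)%:Z).

Lemma valbox_interp_affine a i :
  valbox_interp a = valbox_interp (upd a i 0) *~ (1 - (a i)%:Z)
                    + valbox_interp (upd a i 1) *~ (a i)%:Z.
Proof.
rewrite /valbox_interp !mulrz_suml -big_split; apply: eq_bigr => U _ /=.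
rewrite -!mulrzA -mulrzDr; congr (_ *~ _).
have prodE n :
    \prod_j (if j \in U then (upd a i n j)%:Z else 1 - (upd a i n j)%:Z) =
    (if i \in U then n%:Z else 1 - n%:Z) *
    \prod_(j | j != i) (if j \in U then (a j)%:Z else 1 - (a j)%:Z).
  rewrite (bigD1 i) //= {1 2}/upd eqxx; congr (_ * _).
  by apply: eq_bigr => j /negbTE ji; rewrite /upd ji.
rewrite !prodE (bigD1 i) //=.
by case: ifP => _; rewrite ?subrr ?subr0 ?mul0r ?mul1r ?add0r ?addr0 mulrC.
Qed.

(** Both sides are affine in each side length, so the sides are reduced to 0 or 1 one coordinate at
    a time. For such a vector only its support [U0] has a nonzero coefficient. *)
Lemma valbox_interpE a : valbox a = valbox_interp a.
Proof.
have : forall i, i \notin enum 'I_d -> (a i <= 1)%N by move=> i; rewrite mem_enum.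
elim: (enum 'I_d) a => [|i s IH] a a01; last first.
  rewrite (valbox_affine a i) (valbox_interp_affine a i) -!IH // => j js;
    by rewrite /upd; case: eqVneq => // ji; rewrite a01 // inE negb_or ji.
pose U0 := [set i | a i == 1%N]%SET.
have aE : a =1 ind U0.
  by move=> i; rewrite /ind inE; have := a01 i isT; case: (a i) => [|[]].
rewrite /valbox_interp (bigD1 U0) //= [X in _ + X]big1 ?addr0 => [|U UU0].
  rewrite big1 ?mulr1z => [|i _].
    by rewrite -(funext aE).
  by rewrite aE /ind; case: (i \in U0); rewrite ?subr0.
case: (pickP [pred i | (i \in U) != (i \in U0)]) => [i /= iU|UE].
  rewrite (bigD1 i) //= aE /ind; case: (i \in U) iU; case: (i \in U0) => //=;
  by rewrite ?subrr mul0r mulr0z.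
by case/eqP: UU0; apply/setP => i; have /negbFE/eqP := UE i.
Qed.

Lemma parallelepiped_box (K : {set 'I_d}) (s : nat) :
  parallelepiped v K s%:R = box (fun=> 0%N) (fun i => s * ind K i)%N.
Proof.
apply/seteqP; split => [_ [lam lamb ->]|_ [lam lamb ->]].
  exists (fun i => if i \in K then lam i else 0).
    by move=> i; rewrite /ind; case: ifP => _; rewrite ?muln1 ?muln0 ?lexx.
  by rewrite big_mkcond; apply: eq_bigr => i _; case: ifP; rewrite ?scale0r.
exists lam => [i|].
  have /andP[-> l1] := lamb i; rewrite (le_trans l1) // ler_nat /ind.
  by case: (i \in K); rewrite ?muln1 ?muln0.
rewrite [RHS]big_mkcond; apply: eq_bigr => i _.
case: ifP => iK //; have := lamb i; rewrite /ind iK muln0 => /le_anti <-.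
by rewrite scale0r.
Qed.

(** Faces with the same free directions [L] are translates of each other; the set [A] of coordinates
    fixed at 1 ranges over the subsets of [K :\: L], whence the power of 2. *)
Lemma val_bE (K : {set 'I_d}) :
  val_b phi v K = \sum_(L : {set 'I_d} | L \subset K)
                     valbox (ind L) *~ ((-1) ^+ #|K :\: L| * 2 ^+ #|K :\: L|).
Proof.
rewrite /val_b /val_relint (_ : 1 = 1%:R) // parallelepiped_box.
have -> : box (fun=> 0%N) (fun i => 1 * ind K i)%N = box (fun=> 0%N) (ind K).
  by apply: eq_box => // i; rewrite mul1n.
rewrite nonempty_faces_box.
have sub (L A : {set 'I_d}) i : (ind A i <= ind (A :|: L) i)%N.
  by rewrite /ind inE; case: (i \in A).
have disj (L A : {set 'I_d}) : A \subset K :\: L -> (A :|: L) :\: A = L.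
  rewrite subsetD => /andP[_ AL]; rewrite finset.setDUl finset.setDv finset.set0U.
  by apply/finset.setDidPl; rewrite disjoint_sym.
(* Distinct indices give distinct faces: a box determines its corners, and these determine [A] and
   [L]. *)
rewrite fsbig_image; last first.
  move=> [L A] [L' A']; rewrite !in_setE /= !inE /= => /andP[_ dA] /andP[_ dA'] bb.
  have [bb1 bb2] := (proj1 (seteqP _ _)) bb.
  have le1 := box_subset _ _ _ _ (sub L A) bb1.
  have le2 := box_subset _ _ _ _ (sub L' A') bb2.
  have AE : A = A'.
    apply/setP => i; have [] := le1 i; have [] := le2 i.
    by rewrite /ind; case: (i \in A); case: (i \in A').
  have ALE : A :|: L = A' :|: L'.
    apply/setP => i; have [_] := le1 i; have [_] := le2 i.
    by rewrite /ind; case: (i \in A :|: L); case: (i \in A' :|: L').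
  by congr (_, _) => //; rewrite -(disj _ _ dA) ALE AE disj // .
have -> : [set` face_index K] = [set` enum (face_index K)].
  by apply/seteqP; split => q /=; rewrite mem_enum.
rewrite -fsbig_seq ?enum_uniq // big_enum /=.
transitivity (\sum_(L : {set 'I_d} | L \subset K)
   \sum_(A : {set 'I_d} | A \subset K :\: L) valbox (ind L) *~ (-1) ^+ #|K :\: L|).
  rewrite pair_big_dep; apply: eq_big => [[L A]|[L A]]; first by rewrite inE.
  rewrite inE /= => /andP[LK dA]; rewrite val_box // !box_dim //.
  congr (_ *~ _).
    congr valbox; apply/funext => i; rewrite /ind inE -{2}(disj _ _ dA) !inE.
    by case: (i \in A) => /=; rewrite ?subn0.
  congr (_ ^+ _); rewrite (_ : [set i | (0 < ind K i)%N]%SET = K); last first.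
    by apply/setP => i; rewrite inE /ind lt0b.
  rewrite (_ : [set i | (ind A i < ind (A :|: L) i)%N]%SET = L).
    by rewrite cardsD (finset.setIidPr LK).
  rewrite -[RHS](disj _ _ dA); apply/setP => i; rewrite !inE /ind !inE.
  by case: (i \in A); case: (i \in L).
apply: eq_bigr => L LK; rewrite sumr_const.
have -> : #|[pred A : {set 'I_d} | A \subset K :\: L]| = (2 ^ #|K :\: L|)%N.
  by rewrite -card_powerset; apply: eq_card => A; rewrite !inE.
by rewrite pmulrn mulrzA -natz natrX.
Qed.

(** Coordinates in the basis [v] are unique, so all the facets constrain the same [lam]. *)
Lemma bigcap_upper_facet (S : {set 'I_d}) (s : nat) : S != finset.set0 ->
  \bigcap_(i in [set` S]) upper_facet v s%:R i = box (fun i => s * ind S i)%N (fun=> s).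
Proof.
move=> /finset.set0Pn[i0 i0S]; apply/seteqP; split => [x xF|_ [lam lamb ->] i /= iS].
  have [lam [lamb _ xE]] := xF i0 i0S; exists lam => // i.
  have /andP[l0 ->] := lamb i; rewrite andbT /ind.
  case: (boolP (i \in S)) => iS; rewrite ?muln0 // muln1.
  have [mu [_ <- ]] := xF i iS; rewrite xE => /comb_inj ->.
  by [].
exists lam; split => // [j|].
  by have /andP[l0 ->] := lamb j; rewrite (le_trans _ l0) // ler_nat.
by apply: le_anti; have := lamb i; rewrite /ind iS muln1 andbC.
Qed.

Lemma val_halfopen_alternating (I : {set 'I_d}) (s : nat) :
  val_halfopen phi v I s%:R =
  \sum_(S : {set 'I_d} | S \subset I)
     valbox (fun i => if i \in S then 0%N else s) *~ (-1) ^+ #|S|.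
Proof.
rewrite /val_halfopen /val_removed [RHS](bigD1 finset.set0) ?finset.sub0set //=.
rewrite cards0 expr0 mulr1z parallelepiped_box; congr (_ + _).
  rewrite /valbox; congr phi; apply: eq_box => // i.
  by rewrite /ind !inE muln1.
rewrite -sumrN; apply: eq_bigr => S /andP[SI S0].
rewrite bigcap_upper_facet // val_box; last first.
  by move=> i; rewrite /ind; case: (i \in S); rewrite ?muln1 ?muln0.
rewrite -mulrNz; congr (_ *~ _).
  congr valbox; apply/funext => i; rewrite /ind.
  by case: (i \in S); rewrite ?muln1 ?muln0 ?subnn ?subn0.
(* For nonempty [S] the truncated [#|S| - 1] is exact, and the outer minus restores
   [(-1) ^+ #|S|]. *)
have : (0 < #|S|)%N by rewrite card_gt0.
by case: #|S| => // k _; rewrite subn1 /= exprS mulN1r.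
Qed.

(* Both sides expand in the values of phi at the unit boxes [box 0 (ind U)];
   each coefficient factors over the coordinates, with factor s on U, -s on
   I minus U, and 1 - s elsewhere. *)
Lemma val_halfopenE (I : {set 'I_d}) (s : nat) :
  val_halfopen phi v I s%:R =
  \sum_(K : {set 'I_d})
     val_b phi v K *~ (s%:Z ^+ #|I :|: K| * s.+1%:Z ^+ (d - #|I :|: K|)).
Proof.
rewrite val_halfopen_alternating.
under eq_bigr do rewrite valbox_interpE /valbox_interp mulrz_suml.
rewrite exchange_big /=.
under [RHS]eq_bigr do rewrite val_bE mulrz_suml.
rewrite [RHS](exchange_big_dep xpredT) //=; apply: eq_bigr => U _.
under eq_bigr do rewrite -mulrzA.
under [RHS]eq_bigr do rewrite -mulrzA.
rewrite -!mulrz_sumr; congr (_ *~ _).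
transitivity (\prod_i (if i \in U then s%:Z else if i \in I then - s%:Z else 1 - s%:Z)).
  (* Putting [i] in [S] gives a sign and side 0, with interpolation factor 0 on [U] and 1 elsewhere.
     Vanishing off [I] enforces that [S] lies in [I]. *)
  pose F i : int := if (i \in I) && (i \notin U) then -1 else 0.
  pose H i : int := if i \in U then s%:Z else 1 - s%:Z.
  transitivity (\sum_(S : {set 'I_d}) \prod_i (if i \in S then F i else H i)).
    rewrite big_mkcond; apply: eq_bigr => S _; case: ifPn => [SI|].
      rewrite prod_indicator -big_split; apply: eq_bigr => i _ /=.
      rewrite /F /H; case: (boolP (i \in S)) => [/(fintype.subsetP SI) ->|_];
        last by rewrite mulr1.
      by case: (i \in U); rewrite ?mul0r ?subr0 ?mul1r.
    move=> /fintype.subsetPn[i iS iI].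
    by rewrite (bigD1 i) //= iS /F (negbTE iI) mul0r.
  rewrite -[LHS]bigA_distr; apply: eq_bigr => i _; rewrite /F /H /=.
  case: (i \in I); case: (i \in U) => /=; rewrite ?add0r //.
  by rewrite addrA subrr add0r.
(* For [i] in [K], the factor [s] comes from [I :|: K] and [-2] from [val_bE] off [U]. For [i]
   outside [K], the value 0 of [H] on [U] enforces that [U] lies in [K]. *)
pose F i : int := (if i \in U then 1 else - 2) * s%:Z.
pose H i : int := if i \in U then 0 else if i \in I then s%:Z else s.+1%:Z.
transitivity (\sum_(K : {set 'I_d}) \prod_i (if i \in K then F i else H i)).
  rewrite -[RHS]bigA_distr; apply: eq_bigr => i _; rewrite /F /H /=.
  by case: (i \in I); case: (i \in U) => /=; lia.
rewrite [RHS]big_mkcond; apply: eq_bigr => K _; case: ifPn => [UK|].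
  have -> : (d - #|I :|: K|)%N = #|~: (I :|: K)|.
    by rewrite [RHS]cardsCs finset.setCK card_ord.
  rewrite -exprMn !prod_indicator -!big_split; apply: eq_bigr => i _ /=.
  rewrite /F /H !inE; case: (boolP (i \in U)) => [/(fintype.subsetP UK) ->|_].
    by rewrite orbT /= mulr1 mul1r.
  by case: (i \in I); case: (i \in K) => /=; rewrite ?mulr1 ?mul1r ?mulN1r.
by move=> /fintype.subsetPn[i iU iK]; rewrite (bigD1 i) //= (negbTE iK) /H iU mul0r.
Qed.

End ValuationOfBoxes.
End Boxes.

(* f = g / (1 - t)^(d+1) in the Z[[t]]-module G[[t]] is (1 - t)^(d+1) f = g. *)
Theorem theorem5p4 (R : realType) (d : nat) (G : zmodType)
    (phi : set 'rV[R]_d -> G) (hphi : Zd_valuation phi)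
    (v : 'I_d -> 'rV[R]_d) (hv : forall i, lattice_point (v i))
    (hfree : free [tuple v i | i < d]) (I : {set 'I_d}) :
  forall n : nat,
    poly_mul_series ((1 - 'X) ^+ d.+1)
      (fun k => val_halfopen phi v I (2 * k)%:R) n =
    \sum_(K : {set 'I_d})
      poly_to_series (val_b phi v K) (typeB_eulerian #|I :|: K|.+1 d.+1) n.
Proof.
move=> n; rewrite /poly_mul_series /poly_to_series.
under eq_bigr do rewrite val_halfopenE // mulrz_suml.
rewrite exchange_big; apply: eq_bigr => K _ /=.
under eq_bigr do rewrite -mulrzA.
rewrite -mulrz_sumr -typeB_eulerian_series; last first.
  by rewrite -[X in (_ <= X)%N]card_ord max_card.
by congr (_ *~ _); apply: eq_bigr => i _; rewrite mulrC.
Qed.
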